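(* For all $n\geq1$, $$\sum_{i=1}^{2n-1}P_{2i}+P_{4n-1}=B_{n}^{neobc}+R_{n}^{neobc}.$$
   Context: Pell numbers: $P_0=0$, $P_1=1$, $P_k=2P_{k-1}+P_{k-2}$. A positive integer $m$ is a neo balcobalancing number if there is a positive integer $r$ (its neo balcobalancer) such that $(1+2+\cdots+(m-1))+(1+2+\cdots+m)=2[(m-1)+m+(m+1)+(m+2)+\cdots+(m+r)]$; then $r=\frac{-2m-1+\sqrt{8m^2-12m+9}}{2}$. $B_n^{neobc}$ denotes the $n$-th neo balcobalancing number in increasing order ($n\ge1$) and $R_n^{neobc}$ its neo balcobalancer. *)

(* Defs.v *)
From mathcomp Require Import all_boot.
From mathcomp Require Import boolp classical_sets.

Set Implicit Arguments.
Unset Strict Implicit.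
Unset Printing Implicit Defensive.

Local Open Scope classical_set_scope.
Local Open Scope nat_scope.

Fixpoint pell (k : nat) : nat :=
  match k with
  | 0 => 0
  | k'.+1 => match k' with
             | 0 => 1
             | k''.+1 => 2 * pell k' + pell k''
             end
  end.

(* Since 0 < m, the truncated difference m - 1 is the true one. *)
Definition is_neo_balcobalancer (m r : nat) : Prop :=
  [/\ 0 < m, 0 < r &
      \sum_(1 <= i < m) i + \sum_(1 <= i < m.+1) i
        = 2 * \sum_(m - 1 <= i < (m + r).+1) i].

Definition is_neo_balcobalancing (m : nat) : Prop :=
  exists r, is_neo_balcobalancer m r.

(* m is the n-th in increasing order: it is one of the numbers, and exactly n
   of the numbers lie in {1, ..., m}. *)
Definition is_nth_neo_balcobalancing (n m : nat) : Prop :=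
  is_neo_balcobalancing m /\
  count (fun k => `[< is_neo_balcobalancing k >]) (iota 1 m) = n.

(* xget 0 A is an element of A, or 0 if A is empty. Both sets below have at most
   one element (see the two uniqueness lemmas); 0 belongs to neither, so the
   default value cannot be mistaken for a genuine one. *)
Definition neo_balcobalancing (n : nat) : nat :=
  xget 0 [set m | is_nth_neo_balcobalancing n m].

Definition neo_balcobalancer (n : nat) : nat :=
  xget 0 [set r | is_neo_balcobalancer (neo_balcobalancing n) r].

Lemma is_neo_balcobalancer_inj (m r r' : nat) :
  is_neo_balcobalancer m r -> is_neo_balcobalancer m r' -> r = r'.
Proof.
have lt_sum a b : a < b ->
    \sum_(m - 1 <= i < (m + a).+1) i < \sum_(m - 1 <= i < (m + b).+1) i.
  move=> ab.
  rewrite [ltnRHS](@big_cat_nat _ _ _ (m + a).+1) /=; last 2 first.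
  - by rewrite (leq_trans (leq_subr 1 m)) // -addnS leq_addr.
  - by rewrite ltnS leq_add2l ltnW.
  rewrite -[ltnLHS]addn0 ltn_add2l big_ltn ?ltnS ?ltn_add2l //.
move=> [_ _ e1] [_ _ e2].
move: e1; rewrite e2 => /eqP; rewrite eqn_pmul2l // => /eqP e.
by case: (ltngtP r r') => // /lt_sum; rewrite e ltnn.
Qed.

Lemma is_nth_neo_balcobalancing_inj (n m m' : nat) :
  is_nth_neo_balcobalancing n m -> is_nth_neo_balcobalancing n m' -> m = m'.
Proof.
pose p k := `[< is_neo_balcobalancing k >].
have lt_count a b : a < b -> is_neo_balcobalancing b ->
    count p (iota 1 a) < count p (iota 1 b).
  case: b => // b; rewrite ltnS => ab /asboolP hb.
  rewrite -[b.+1]addn1 iotaD count_cat /= add1n.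
  have -> : p b.+1 by [].
  rewrite addn1 ltnS -(subnKC ab).
  by rewrite iotaD count_cat leq_addr.
move=> [hm e1] [hm' e2].
by case: (ltngtP m m') => // lt; move: (lt_count _ _ lt); rewrite /p e1 e2 ltnn;
  [move=> /(_ hm') | move=> /(_ hm)].
Qed.

(* Main.v *)
Require Import Defs.
From mathcomp Require Import all_boot.
From mathcomp Require Import boolp classical_sets.
From mathcomp Require Import zify.
Local Open Scope nat_scope.

(**
  With s = m + r the defining equation reads s (s + 1) + 3 m = 2 m^2 + 2, that
  is x^2 - 2 y^2 = -9 for x = 4 m - 3 and y = 2 s + 1. Multiplication by the
  unit 17 + 12 sqrt 2 sends solutions with x = 1 modulo 4 to such solutions, and
  its inverse gives a descent from any solution with m > 6 to a smaller positive
  one; as (6, 7) is the only solution with m <= 6, all solutions form the orbit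
  of (6, 7). Along this orbit 2 s + 1 = 3 P_{4k+3}, while
  2 (P_2 + P_4 + ... + P_{2k}) + 1 = P_{2k+1}.
*)

#[local] Arguments pell : simpl never.

Lemma pellSS k : pell k.+2 = 2 * pell k.+1 + pell k.
Proof. by []. Qed.

Lemma sum_pell_even k :
  2 * (\sum_(1 <= i < k.+1) pell (2 * i)) + 1 = pell (2 * k).+1.
Proof.
elim: k => [|k IHk]; first by rewrite big_geq.
rewrite big_nat_recr // mulnDr addnAC IHk.
by rewrite (_ : 2 * k.+1 = (2 * k).+2) 1?addnC //; lia.
Qed.

(** Gauss's formula with every subtracted term moved across the equality, so that truncated
    subtraction never enters. *)
Lemma double_sum_nat a b : a <= b ->
  2 * (\sum_(a <= i < b) i) + a * a + b = b * b + a.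
Proof.
elim: b => [|b IHb]; first by rewrite leqn0 => /eqP ->; rewrite big_geq.
rewrite leq_eqVlt => /predU1P [->|ab]; first by rewrite big_geq.
by rewrite big_nat_recr //= mulnDr; have := IHb ab; lia.
Qed.

Definition neo_balco_eq (m s : nat) : Prop :=
  s * s.+1 + 3 * m = 2 * m ^ 2 + 2.

Lemma is_neo_balcobalancerE m r :
  is_neo_balcobalancer m r <-> [/\ 0 < m, 0 < r & neo_balco_eq m (m + r)].
Proof.
rewrite /is_neo_balcobalancer /neo_balco_eq; case: m => [|m]; first by split; case.
have := @double_sum_nat 1 m.+1 isT.
have := @double_sum_nat 1 m.+2 isT.
have : m <= (m.+1 + r).+1 by lia.
move/double_sum_nat; rewrite subSS subn0.
set A := \sum_(1 <= i < m.+1) i; set B := \sum_(1 <= i < m.+2) i.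
set C := \sum_(m <= i < _) i; move: A B C => A B C eC eB eA.
by split=> -[m0 r0 e]; split=> //; lia.
Qed.

(** Multiplication of [x + y sqrt 2] by [17 + 12 sqrt 2], rewritten through [x = 4 m - 3] and
    [y = 2 s + 1]. The smaller unit [3 + 2 sqrt 2] would send [x] to [-x] modulo 4, hence its
    square. *)
Fixpoint neo_balco_pair (k : nat) : nat * nat :=
  if k is k'.+1 then
    let: (m, s) := neo_balco_pair k' in
    (17 * m + 12 * s - 6, 24 * m + 17 * s - 10)
  else (6, 7).

Lemma neo_balco_pairP k (m := (neo_balco_pair k).1) (s := (neo_balco_pair k).2) :
  [/\ 6 <= m, m < s & neo_balco_eq m s].
Proof.
rewrite /m /s /neo_balco_eq {m s}; elim: k => //= k.
case: (neo_balco_pair k) => m s /= [m6 ms e].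
(* Shifting by the starting point (6, 7) makes the truncated subtractions disappear. *)
have [u eu] : exists u, m = u + 6 by exists (m - 6); lia.
have [t et] : exists t, s = t + 7 by exists (s - 7); lia.
rewrite (_ : 17 * m + 12 * s - 6 = 17 * u + 12 * t + 180); last by lia.
rewrite (_ : 24 * m + 17 * s - 10 = 24 * u + 17 * t + 253); last by lia.
by subst m s; split; lia.
Qed.

(** In closed form [x + y sqrt 2 = 3 (1 + sqrt 2)^(4k+3)], because
    [(1 + sqrt 2)^4 = 17 + 12 sqrt 2]. The identity for [m] is carried along since the recursion for
    [s] involves [m]. *)
Lemma neo_balco_pair_pell k (m := (neo_balco_pair k).1)
    (s := (neo_balco_pair k).2) :
  2 * s + 1 = 3 * pell (4 * k).+3 /\
  4 * m = 3 * (pell (4 * k).+3 + pell (4 * k).+2) + 3.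
Proof.
rewrite /m /s {m s}; elim: k => // k.
have [] := neo_balco_pairP k; rewrite [neo_balco_pair k.+1]/=.
case: (neo_balco_pair k) => m s /= m6 ms _ [es em].
rewrite (_ : 4 * k.+1 = (4 * k).+4); last by lia.
by rewrite !pellSS in es em *; lia.
Qed.

Lemma neo_balco_pair_ltn : {homo (fun k => (neo_balco_pair k).1) : i j / i < j}.
Proof.
apply: homo_ltn ltn_trans _ => k /=.
by have := neo_balco_pairP k; case: (neo_balco_pair k) => m s /= []; lia.
Qed.

Lemma neo_balco_descent m s : 6 < m -> neo_balco_eq m s ->
  exists m0 s0, [/\ 0 < m0 < m, neo_balco_eq m0 s0,
    m = 17 * m0 + 12 * s0 - 6 & s = 24 * m0 + 17 * s0 - 10].
Proof.
rewrite /neo_balco_eq => m6 e.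
(* The inverse unit [17 - 12 sqrt 2] gives [m0 = 17 m - 12 s - 18] and [s0 = 17 s - 24 m + 26]. The
   three bounds say [0 < m0], [0 <= s0] and [m0 < m]; below, [c] is [m0 - 1] and [b] is [s0]. *)
have h1 : 12 * s + 18 < 17 * m by nia.
have h2 : 24 * m <= 17 * s + 26 by nia.
have h3 : 16 * m < 12 * s + 18 by nia.
have [c ec] : exists c, 17 * m = c + (12 * s + 19).
  by exists (17 * m - (12 * s + 19)); lia.
have [b eb] : exists b, 17 * s + 26 = b + 24 * m.
  by exists (17 * s + 26 - 24 * m); lia.
have em : m = 17 * c + 12 * b + 11 by lia.
have es : s = 24 * c + 17 * b + 14 by lia.
by exists c.+1, b; clear h1 h2 h3 ec eb; subst m s; split; lia.
Qed.

Lemma neo_balco_eq_pair m s : 0 < m -> neo_balco_eq m s ->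
  exists k, (m, s) = neo_balco_pair k.
Proof.
elim/ltn_ind: m s => m IHm s m0 e.
have [m6|m6] := ltnP 6 m.
  have [a [b [/andP [a0 am] eab -> ->]]] := neo_balco_descent _ _ m6 e.
  by have [k ek] := IHm _ am _ a0 eab; exists k.+1; rewrite /= -ek.
exists 0; move: e; rewrite /neo_balco_eq => e.
(* Only finitely many pairs remain, and they are checked by computation. *)
have s8 : s <= 8 by nia.
have /allP/(_ m) : all (fun a => all (fun b =>
    (b * b.+1 + 3 * a == 2 * a ^ 2 + 2) ==> ((a, b) == (6, 7))) (iota 0 9))
  (iota 1 6) by [].
rewrite mem_iota m0 => /(_ m6)/allP/(_ s).
by rewrite mem_iota e eqxx => /(_ s8)/eqP.
Qed.

Lemma is_neo_balcobalancingP m :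
  is_neo_balcobalancing m <-> exists k, m = (neo_balco_pair k).1.
Proof.
split=> [[r /is_neo_balcobalancerE [m0 _ e]]|[k ->]].
  by have [k ek] := neo_balco_eq_pair _ _ m0 e; exists k; rewrite -ek.
have [] := neo_balco_pairP k; case: (neo_balco_pair k) => a b /= a6 ab e.
exists (b - a); apply/is_neo_balcobalancerE.
by split; rewrite ?subnKC //; lia.
Qed.

(** Passes from an increasing enumeration to ranks: each window from just after [f n] up to [f n.+1]
    adds exactly one element. Ranks start at 1 and [f] at index 0, hence [n.+1]. *)
Lemma count_increasing_range (p : pred nat) (f : nat -> nat) :
  {homo f : i j / i < j} -> (forall m, p m <-> exists k, m = f k) -> 0 < f 0 ->
  forall n, count p (iota 1 (f n)) = n.+1.
Proof.
move=> f_lt pP f0.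
have f_mono : {mono f : i j / i < j} by exact: leqW_mono (leq_mono f_lt).
have pf n : p (f n) by apply/pP; exists n.
(* The premise says that no value of [f] lies in the window before its last point [f n]. *)
have gap a d n : (forall j, a <= f j < a + d -> f n <= f j) -> a + d = f n ->
    count p (iota a d.+1) = 1.
  move=> gapP e; rewrite -addn1 iotaD count_cat /= e pf.
  rewrite [X in X + _](_ : _ = 0) //; apply/eqP; rewrite -leqn0 leqNgt -has_count.
  apply/hasPn => x; rewrite mem_iota => xad; apply/negP => /pP [j ej].
  by have := gapP j; rewrite -ej; lia.
elim=> [|n IHn].
  rewrite -(prednK f0); apply: (gap _ _ 0); last by lia.
  by move=> j _; case: j => // j; exact: ltnW (f_lt _ _ _).
have lt_n := f_lt _ _ (ltnSn n).
rewrite -(subnKC lt_n) addSnnS iotaD count_cat IHn (gap _ _ n.+1) ?addn1 //; last by lia.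
move=> j /andP []; rewrite add1n f_mono => nj _.
by rewrite leqNgt f_mono -leqNgt.
Qed.

Lemma neo_balcobalancingS n : neo_balcobalancing n.+1 = (neo_balco_pair n).1.
Proof.
have h : is_nth_neo_balcobalancing n.+1 (neo_balco_pair n).1.
  split; first by apply/is_neo_balcobalancingP; exists n.
  apply: (count_increasing_range _ (fun k => (neo_balco_pair k).1)) => //.
    exact: neo_balco_pair_ltn.
  by move=> m; rewrite -is_neo_balcobalancingP; split=> /asboolP.
by apply: xget_unique => // m hm; exact: is_nth_neo_balcobalancing_inj hm h.
Qed.

Lemma neo_balcobalancerS n :
  neo_balcobalancer n.+1 = (neo_balco_pair n).2 - (neo_balco_pair n).1.
Proof.
have [m6 ms e] := neo_balco_pairP n.
have h : is_neo_balcobalancer (neo_balco_pair n).1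
    ((neo_balco_pair n).2 - (neo_balco_pair n).1).
  by apply/is_neo_balcobalancerE; rewrite subnKC; [split=> // | ]; lia.
rewrite /neo_balcobalancer neo_balcobalancingS.
by apply: xget_unique => // r hr; exact: is_neo_balcobalancer_inj hr h.
Qed.

Theorem theorem9p4 (n : nat) (hn : 1 <= n) :
  \sum_(1 <= i < 2 * n) pell (2 * i) + pell (4 * n - 1)
    = neo_balcobalancing n + neo_balcobalancer n.
Proof.
case: n hn => // n _.
have [_ ms _] := neo_balco_pairP n; have [es _] := neo_balco_pair_pell n.
rewrite neo_balcobalancingS neo_balcobalancerS subnKC; last exact: ltnW.
(* With [P = pell (4 * n).+3], the sum equals [(P - 1) / 2]; adding [P] gives [(3 P - 1) / 2], which
   is [s]. *)
have := sum_pell_even (2 * n).+1.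
rewrite (_ : (2 * n).+2 = 2 * n.+1); last by lia.
rewrite (_ : (2 * (2 * n).+1).+1 = (4 * n).+3); last by lia.
rewrite (_ : 4 * n.+1 - 1 = (4 * n).+3); last by lia.
lia.
Qed.
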